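(* Let $A$ be a packing bound function. For every $C\in\mathcal{B}$, $\operatorname{pack}(C)\le A(C)$.
   Context: For a bounded set $C\subseteq\mathbb{R}^d$, $\operatorname{pack}(C)$ is the largest possible size of a subset $X$ of $C$ such that all distinct points of $X$ are at distance at least $2$ from each other. Let $\mathcal{B}_d$ be the set of all bounded Borel subsets of $\mathbb{R}^d$ and $\mathcal{B} = \bigcup_d \mathcal{B}_d$. Write $d(x,y)=|x-y|$ for the Euclidean metric, $d(C,C') = \inf\{d(x,x') : x\in C, x'\in C'\}$ (equal to $\infty$ if $C$ or $C'$ is empty), and $C(\varepsilon) = \{x \in \mathbb{R}^d : d(x,C)<\varepsilon\}$ for $C \subseteq \mathbb{R}^d$. A function $\psi\colon C \to C'$ (possibly between subsets of Euclidean spaces of different dimensions) is distance-increasing if $d(\psi(x),\psi(y)) \ge d(x,y)$ for all $x,y\in C$. A packing bound function is a map $A\colon \mathcal{B}\to[0,\infty)$ such that for all $C,C'\in\mathcal{B}$ and $\varepsilon>0$: (1) (Sphere bound) if $C$ is nonempty and contained in the interior of a ball of radius $1$, then $A(C)=1$; (2) (Lipschitz inequality) if there exists a distance-increasing function $\psi\colon C\to C'$, then $A(C)\le A(C')$; (3) (Union axiom) if $C$ and $C'$ are subsets of the same ambient space $\mathbb{R}^d$ and $d(C,C')\ge 2$, then $A(C\cup C')=A(C)+A(C')$; (4) (Mesh axiom) if $C \subseteq C'(\varepsilon)$ (in the same ambient space), then $A(\frac{1}{1+\varepsilon}C)\le A(C')$. *)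

(* Defs.v *)
From HB Require Import structures.
From mathcomp Require Import all_boot all_order all_algebra.
From mathcomp Require Import all_classical all_reals all_analysis.

Set Implicit Arguments.
Unset Strict Implicit.
Unset Printing Implicit Defensive.

Import Order.TTheory GRing.Theory Num.Theory.
Import numFieldNormedType.Exports.

Local Open Scope classical_set_scope.
Local Open Scope ring_scope.

(* The norm `|x| that the library puts on 'rV[R]_d is the sup norm, so all
   metric notions below go through [edist2]. Only [bounded_set], [open] and
   [interior] are taken from the library: they are the same for the two norms. *)
Definition edist2 (R : realType) (d : nat) (x y : 'rV[R]_d) : R :=
  Num.sqrt (\sum_(i < d) (x ord0 i - y ord0 i) ^+ 2).

(* Equal to +oo when C or C' is empty. *)
Definition set_edist (R : realType) (d : nat) (C C' : set 'rV[R]_d) : \bar R :=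
  ereal_inf [set (edist2 x y)%:E | x in C & y in C'].

Definition fattening (R : realType) (d : nat) (C : set 'rV[R]_d) (e : R) :
    set 'rV[R]_d :=
  [set x | (set_edist [set x] C < e%:E)%E].

Definition eball (R : realType) (d : nat) (c : 'rV[R]_d) (r : R) :
    set 'rV[R]_d :=
  [set x | edist2 c x <= r].

Definition bounded_borel (R : realType) (d : nat) : set (set 'rV[R]_d) :=
  [set C | bounded_set C /\ <<s [set U : set 'rV[R]_d | open U] >> C].

Definition separated2 (R : realType) (d : nat) (X : set 'rV[R]_d) : Prop :=
  forall x y, X x -> X y -> x <> y -> 2 <= edist2 x y.

(* [counting X] is the cardinal of X, and +oo for an infinite X. A set of
   extended natural numbers whose supremum is finite attains it, so [pack C] is
   a maximum as soon as it is finite. *)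
Definition pack (R : realType) (d : nat) (C : set 'rV[R]_d) : \bar R :=
  ereal_sup [set @counting 'rV[R]_d R X | X in
               [set X : set 'rV[R]_d | X `<=` C /\ separated2 X]].

(* Only the values of psi on C matter. *)
Definition distance_increasing (R : realType) (d d' : nat)
    (C : set 'rV[R]_d) (C' : set 'rV[R]_d') (psi : 'rV[R]_d -> 'rV[R]_d') :
    Prop :=
  set_fun C C' psi /\
  forall x y, C x -> C y -> edist2 x y <= edist2 (psi x) (psi y).

(* A map from bounded Borel sets to [0, oo[ is encoded as a function on all
   subsets, whose values outside [bounded_borel] are never constrained. *)
Record packing_bound_function (R : realType)
    (A : forall d : nat, set 'rV[R]_d -> R) : Prop := {
  pbf_ge0 : forall (d : nat) (C : set 'rV[R]_d),
    bounded_borel C -> 0 <= A d C ;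
  pbf_sphere : forall (d : nat) (C : set 'rV[R]_d),
    bounded_borel C -> C !=set0 ->
    (exists c : 'rV[R]_d, C `<=` interior (eball c 1)) ->
    A d C = 1 ;
  pbf_lipschitz : forall (d d' : nat) (C : set 'rV[R]_d) (C' : set 'rV[R]_d'),
    bounded_borel C -> bounded_borel C' ->
    (exists psi, distance_increasing C C' psi) ->
    A d C <= A d' C' ;
  pbf_union : forall (d : nat) (C C' : set 'rV[R]_d),
    bounded_borel C -> bounded_borel C' ->
    (2%:E <= set_edist C C')%E ->
    A d (C `|` C') = A d C + A d C' ;
  pbf_mesh : forall (d : nat) (C C' : set 'rV[R]_d) (e : R),
    bounded_borel C -> bounded_borel C' -> 0 < e ->
    C `<=` fattening C' e ->
    A d [set (1 / (1 + e)) *: x | x in C] <= A d C'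
}.

(* Main.v *)
(* A finite 2-separated set is a union of singletons at pairwise distance at
   least 2, so the union axiom and the sphere bound give A(X) = #X; the identity
   X -> C is distance-increasing, hence #X <= A(C). This bounds the finite
   subsets of any separated X in C, so X cannot be infinite. *)

Require Import Defs.
From mathcomp Require Import all_boot all_order all_algebra.
From mathcomp Require Import finmap all_classical all_reals all_analysis.

Set Implicit Arguments.
Unset Strict Implicit.
Unset Printing Implicit Defensive.

Import Order.TTheory GRing.Theory Num.Theory.
Import numFieldNormedType.Exports.

Local Open Scope classical_set_scope.
Local Open Scope ring_scope.

(** Supplies the side condition of the axioms for every finite set used below. *)
Lemma finite_set_bounded_borel (R : realType) (d : nat) (X : set 'rV[R]_d) :
  finite_set X -> bounded_borel X.
Proof.
move=> finX; split; first exact/compact_bounded/finite_compact.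
have clX : closed X.
  move: X finX; apply/accessible_finite_set_closed.
  exact/hausdorff_accessible/norm_hausdorff.
rewrite -[X]setCK; apply: sigma_algebraC; apply: sub_gen_smallest.
exact: closed_openC.
Qed.

Lemma eball_interior_center (R : realType) (d : nat) (c : 'rV[R]_d) :
  interior (eball c 1) c.
Proof.
(* Library balls are sup-norm balls: radius 1/(d+1) suffices, as d/(d+1)^2 <= 1. *)
have e0 : 0 < d.+1%:R^-1 :> R by rewrite invr_gt0.
apply/nbhs_ballP; exists d.+1%:R^-1 => //= y [_ cy].
rewrite /eball/= /edist2 -[leRHS]sqrtr1 ler_wsqrtr//.
(* In each square, one factor is at most 1/(d+1) and the other at most 1; the sum is then at most
   d/(d+1). *)
apply: (@le_trans _ _ (\sum_(i < d) d.+1%:R^-1)); last first.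
  rewrite sumr_const card_ord -[_ *+ _]mulr_natl ler_pdivrMr// mul1r.
  by rewrite ler_nat.
apply: ler_sum => i _; rewrite -real_normK ?num_real// expr2.
have /ltW h := cy ord0 i; rewrite /ball/= in h.
rewrite -[leRHS]mulr1 ler_pM// (le_trans h)// invf_le1//.
by rewrite ler1n.
Qed.

(** The empty set is at distance [+oo] from itself, so the union axiom makes its value equal to
    twice itself. *)
Lemma pbf_set0 (R : realType) (A : forall d : nat, set 'rV[R]_d -> R)
    (hA : packing_bound_function A) (d : nat) :
  A d set0 = 0.
Proof.
have b0 : bounded_borel (set0 : set 'rV[R]_d).
  exact/finite_set_bounded_borel/finite_set0.
have : A d (set0 `|` set0) = A d set0 + A d set0.
  by apply: (pbf_union hA) => //; apply/ereal_infP => y [x []].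
by rewrite setU0 -[LHS]addr0 => /addrI.
Qed.

Lemma pbf_separated_seq (R : realType) (A : forall d : nat, set 'rV[R]_d -> R)
    (hA : packing_bound_function A) (d : nat) (s : seq 'rV[R]_d) :
  uniq s -> separated2 [set` s] -> A d [set` s] = (size s)%:R.
Proof.
elim: s => [_ _|a s IHs /= /andP[as_ us] sep]; first by rewrite set_nil pbf_set0.
have {}IHs : A d [set` s] = (size s)%:R.
  by apply: IHs => // x y /= xs ys; apply: sep; rewrite /= inE ?xs ?ys orbT.
have ba : bounded_borel [set a] by exact/finite_set_bounded_borel/finite_set1.
have bs : bounded_borel [set` s] by exact/finite_set_bounded_borel/finite_seq.
have -> : [set` a :: s] = [set a] `|` [set` s].
  apply/seteqP; split=> x /=; rewrite inE.
    by case/predU1P; [left|right].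
  by case=> [->|->]; rewrite ?eqxx ?orbT.
rewrite (pbf_union hA)// ?IHs.
  rewrite (pbf_sphere hA) ?natr1 ?nat1r//; first by exists a.
  by exists a => _ ->; exact: eball_interior_center.
(* The union axiom needs [a] at distance at least 2 from each [y] in [s]; uniqueness of the list
   gives [a <> y], so separation applies. *)
apply/ereal_infP => _ [_ -> [y /= ys <-]]; rewrite lee_fin.
apply: sep; rewrite /= ?inE ?eqxx ?ys ?orbT//.
by move=> ay; rewrite ay ys in as_.
Qed.

Lemma pbf_subset (R : realType) (A : forall d : nat, set 'rV[R]_d -> R)
    (hA : packing_bound_function A) (d : nat) (C C' : set 'rV[R]_d) :
  bounded_borel C -> bounded_borel C' -> C `<=` C' -> A d C <= A d C'.
Proof. by move=> bC bC' CC'; apply: (pbf_lipschitz hA) => //; exists id. Qed.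

Theorem corollary2p3 (R : realType) (A : forall d : nat, set 'rV[R]_d -> R)
    (hA : packing_bound_function A)
    (d : nat) (C : set 'rV[R]_d) (hC : bounded_borel C) :
  (pack C <= (A d C)%:E)%E.
Proof.
have fset_le (B : {fset 'rV[R]_d}) : [set` B] `<=` C -> separated2 [set` B] ->
    #|` B|%:R <= A d C.
  move=> BC sepB; rewrite -(pbf_separated_seq hA (fset_uniq B) sepB).
  by apply: pbf_subset => //; exact/finite_set_bounded_borel/finite_fset.
apply/ereal_supP => _ [X [XC sepX] <-]; rewrite /counting.
case: asboolP => [finX|infX].
  by rewrite lee_fin; apply: fset_le; rewrite fset_setK.
(* Here [counting X] is [+oo], so a contradiction is needed: a finite subset of [X] with at least
   floor(A(C)) + 1 points, hence more than A(C). *)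
have [B BX ltB] := infinite_set_fset (Num.truncn (A d C)).+1 infX.
have : #|` B|%:R <= A d C.
  by apply: fset_le => [|x y /BX Xx /BX Xy]; [exact: subset_trans XC|exact: sepX].
by rewrite leNgt (lt_le_trans (truncnS_gt _))// ler_nat.
Qed.
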